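(* Let $\Bbbk$ be an algebraically closed field of characteristic $0$, let $A$ be the incidence algebra over $\Bbbk$ of $\mathfrak{S}_n$ with respect to the Bruhat order, and let $v\in\mathfrak{S}_n$ be the longest element of some parabolic subgroup. Then $\mathbf{grade}(L_v)=\mathbf{a}(v)=\ell(v)$.
   Context: $\mathfrak{S}_n$ has simple reflections $\sigma_i=(i,i+1)$ and length function $\ell$; a parabolic subgroup is generated by a subset of the simple reflections. $A$ is the path algebra of the quiver with vertices $\mathfrak{S}_n$ and an arrow $p\to q$ whenever $p$ covers $q$ in the Bruhat order, modulo the relations that all paths with the same endpoints coincide. $L_v$ is the simple module one-dimensional at vertex $v$. Modules are finite-dimensional left modules; $\mathbf{grade}(M)=\min\{i:\mathrm{Ext}^i_A(M,A)\ne0\}$. Lusztig's $\mathbf{a}$-function on $\mathfrak{S}_n$ is the unique function constant on two-sided Kazhdan–Lusztig cells (sets of permutations with equal Robinson–Schensted shape) with $\mathbf{a}(w)=\ell(w)$ for $w$ the longest element of a parabolic subgroup. *)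

(* Defs.v *)
From HB Require Import structures.
From mathcomp Require Import all_boot all_order all_algebra all_fingroup.

Set Implicit Arguments.
Unset Strict Implicit.
Unset Printing Implicit Defensive.

Import GRing.Theory.

Definition perm_len n (w : {perm 'I_n}) : nat :=
  #|[set p : 'I_n * 'I_n | (p.1 < p.2)%N && (w p.2 < w p.1)%N]|.

Definition simple_refls n : {set {perm 'I_n}} :=
  [set w : {perm 'I_n} | [exists i : 'I_n, exists j : 'I_n,
     (val j == (val i).+1) && (w == tperm i j)]].

Definition bruhat_step n (u w : {perm 'I_n}) : bool :=
  [exists i : 'I_n, exists j : 'I_n,
     [&& i != j, w == (u * tperm i j)%g & (perm_len u < perm_len w)%N]].

Definition bruhat_le n : rel {perm 'I_n} := connect (@bruhat_step n).

Definition longest_of_parabolic n (J : {set {perm 'I_n}}) (v : {perm 'I_n}) :=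
  [/\ J \subset simple_refls n, (v \in <<J>>)%g &
      forall w, (w \in <<J>>)%g -> (perm_len w <= perm_len v)%N].

(* The incidence algebra A of (S_n, Bruhat order) over a field k.       *)
(* Basis: xi_(q,p) for q <= p, thought of as the (unique up to the      *)
(* relations) path p -> q in the quiver (arrows p -> q, p covers q).    *)
(* Product: xi_(r,q') xi_(q,p) = [q' = q] xi_(r,p)  (composition).      *)

Definition IBasis n := {x : {perm 'I_n} * {perm 'I_n} | bruhat_le x.1 x.2}.

Definition mulB n (a b : IBasis n) : option (IBasis n) :=
  if (val a).2 == (val b).1 then (insub ((val a).1, (val b).2) : option (IBasis n)) else None.

Local Open Scope ring_scope.

(* A finite-dimensional left A-module: a k-vector space k^mdim with the
   action of each basis element as a matrix (acting on column vectors). *)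
Record Amod (k : fieldType) n := AMod {
  mdim : nat;
  mact : IBasis n -> 'M[k]_mdim }.

Definition optact (k : fieldType) n (M : Amod k n) (o : option (IBasis n))
  : 'M[k]_(mdim M) := if o is Some a then mact M a else 0.

Definition simpleL (k : fieldType) n (v : {perm 'I_n}) : Amod k n :=
  @AMod k n 1 (fun a => ((val a == (v, v))%:R)%:M).

Definition regA (k : fieldType) n : Amod k n :=
  @AMod k n #|{: IBasis n}| (fun a =>
    \matrix_(j, i) ((mulB a (enum_val i) == Some (enum_val j))%:R)).

(* Ext^i_A(M, N) computed with the (standard) bar resolution            *)
(*   ... -> A (x) A^{(x)i} (x) M -> ... -> A (x) M -> M -> 0,           *)
(* so that Ext^i_A(M,N) = H^i of C^i = Hom_k(A^{(x)i} (x) M, N).        *)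
(* A cochain of degree i is given by its values on i-tuples of basis    *)
(* elements (stored as sequences of size i): f s : Hom_k(M, N).         *)

Definition cochain (k : fieldType) n (M N : Amod k n) :=
  seq (IBasis n) -> 'M[k]_(mdim N, mdim M).

(* (d f)(a_1 .. a_{i+1}, m) = a_1 f(a_2 .. a_{i+1}, m)
     + sum_{j=1}^{i} (-1)^j f(a_1 .. a_j a_{j+1} .. a_{i+1}, m)
     + (-1)^{i+1} f(a_1 .. a_i, a_{i+1} m)                              *)
Definition cobound (k : fieldType) n (M N : Amod k n) (i : nat)
  (f : cochain M N) : cochain M N := fun s =>
  optact N (ohead s) *m f (behead s)
  + \sum_(j < i) (-1) ^+ j.+1 *:
      (match onth s j, onth s j.+1 with
       | Some a, Some b =>
           if mulB a b is Some c then f (take j s ++ c :: drop j.+2 s) else 0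
       | _, _ => 0
       end)
  + (-1) ^+ i.+1 *: (f (take i s) *m optact M (onth s i)).

Definition is_cocycle (k : fieldType) n (M N : Amod k n) (i : nat)
  (f : cochain M N) : Prop :=
  forall s, size s = i.+1 -> cobound i f s = 0.

Definition is_coboundary (k : fieldType) n (M N : Amod k n) (i : nat)
  (f : cochain M N) : Prop :=
  match i with
  | 0 => f [::] = 0
  | i'.+1 => exists g : cochain M N,
      forall s, size s = i -> f s = cobound i' g s
  end.

Definition Ext_nonzero (k : fieldType) n (i : nat) (M N : Amod k n) : Prop :=
  exists f : cochain M N, is_cocycle i f /\ ~ is_coboundary i f.

Definition is_grade (k : fieldType) n (M : Amod k n) (g : nat) : Prop :=
  Ext_nonzero g M (regA k n) /\
  forall i, (i < g)%N -> ~ Ext_nonzero i M (regA k n).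

(* Main.v *)
(* Sorting basis elements of A by their source p splits Ext^i(L_v, A) into groups
   H^i(L_v, k_E) with E = [e, p], where k_E is the module spanned by a convex set E.
   If E is stable, below v, under x |-> xs for a simple reflection s with vs < v, these groups
   vanish in all degrees: x |-> min(x, xs) is monotone (lifting property), lies below the identity
   and moves v, so the prism homotopy contracts the bar complex.
   The elements below v that are below p have a maximum q. If q <> e, any descent s of q makes
   [e, p] stable below v. If q = e, then adding s in J to [e, p] gives a stable set, whence
   H^i(L_v, k_[e,p]) = H^(i-1)(L_v, L_s); likewise {x, xs} is stable, so
   H^i(L_v, L_x) = H^(i-1)(L_v, L_xs) whenever x < xs, and climbing from x to v shows that only
   the degree l(v) - l(x) survives, where the group is Hom(L_v, L_v). *)

Require Import Defs.
From HB Require Import structures.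
From mathcomp Require Import all_boot all_order all_algebra all_fingroup.
From mathcomp Require Import zify ring.

Set Implicit Arguments.
Unset Strict Implicit.
Unset Printing Implicit Defensive.

(** * Lengths, simple reflections and the Bruhat order *)

Section Bruhat.
Variable n : nat.
Implicit Types (u w x y s : {perm 'I_n}) (J : {set {perm 'I_n}}).
Local Open Scope group_scope.

Definition invset w := [set p : 'I_n * 'I_n | (p.1 < p.2)%N && (w p.2 < w p.1)%N].

Lemma tpermVE (i j z : 'I_n) : tperm i j z = if z == i then j else if z == j then i else z.
Proof. by case: tpermP => [->|->|/eqP/negPf-> /eqP/negPf->]; rewrite ?eqxx //; case: eqP. Qed.

(** Inversions of [u] inject into those of the product: [phi] fixes a pair with a coordinate
    strictly between the positions [a] and [b], and applies the transposition [t] of [a] and [b] to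
    any other pair. The new inversion [(a, b)] is missed. *)
Lemma ltn_perm_len_tperm u (i j : 'I_n) :
  (i < j)%N -> (u^-1 i < u^-1 j)%N -> (perm_len u < perm_len (u * tperm i j))%N.
Proof.
move=> ij; set a := u^-1 i; set b := u^-1 j => ab.
have ua : u a = i by rewrite /a permKV.
have ub : u b = j by rewrite /b permKV.
have [inn innE] : {inn : 'I_n -> bool | forall z, inn z = (a < z < b)%N}.
  by exists (fun z : 'I_n => (a < z < b)%N).
have [t tE] : {t | t = tperm a b} by exists (tperm a b).
pose phi (p : 'I_n * 'I_n) := if inn p.1 || inn p.2 then p else (t p.1, t p.2).
have inn_t z : inn (t z) = inn z.
  by rewrite !innE tE; case: tpermP => [->|->|//]; lia.
have phiK : involutive phi.
  move=> [x y]; rewrite /phi /=; case H: (inn x || inn y) => /=; rewrite ?H //.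
  by rewrite !inn_t H tE !tpermK.
have wE z : (u * tperm i j) z = u (t z).
  rewrite permM; rewrite tE !tpermVE -!ua -!ub !(inj_eq perm_inj) ua ub.
  by case: eqP => // _; case: eqP.
rewrite /perm_len -!/(invset _) -(card_imset (invset u) (can_inj phiK)).
apply: proper_card; apply/properP; split; last first.
  exists (a, b).
    by rewrite !inE /= ab !wE tE tpermL tpermR ua ub.
  apply/imsetP => -[[x y]]; rewrite !inE /= => /andP[xy uxy] /(congr1 phi).
  rewrite phiK {1}/phi !innE /= !ltnn andbF /= tE tpermL tpermR => -[xb ya].
  by rewrite -xb -ya in xy; lia.
apply/subsetP => _ /imsetP[[x y] + ->]; rewrite !inE /phi /= => /andP[xy uxy].
case: ifP => /= H; last first.
  rewrite !wE tE !tpermK uxy andbT !tpermVE.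
  have [xa|xa] := eqVneq x a; have [yb|yb] := eqVneq y b.
  - by move: uxy; rewrite xa yb ua ub; lia.
  - by move: H yb xy; rewrite !innE -!val_eqE /= xa ltnn /= => H yb xy; do 4?case: ifP => ?; lia.
  - move: H xa xy; rewrite !innE -!val_eqE /= yb ltnn andbF orbF => H xa xy.
    by do 4?case: ifP => ?; lia.
  by move: H xa yb; rewrite !innE -!val_eqE /= => H xa yb; do 4?case: ifP => ?; lia.
rewrite xy !wE tE !tpermVE /=.
move: uxy H; rewrite !innE.
have [xa|xa] := eqVneq x a; have [yb|yb] := eqVneq y b; rewrite -?val_eqE /=.
- by rewrite xa yb ua ub; lia.
- by move: xy; rewrite xa ua => xy uxy H; do 4?case: ifP => ?; rewrite ?ub; lia.
- by move: xy; rewrite yb ub => xy uxy H; do 4?case: ifP => ?; rewrite ?ua; lia.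
by move=> uxy H; do 4?case: ifP => ?; rewrite ?ua ?ub; lia.
Qed.

Lemma perm_len_tperm u (i j : 'I_n) :
  (i < j)%N -> (perm_len u < perm_len (u * tperm i j))%N = (u^-1 i < u^-1 j)%N.
Proof.
move=> ij; apply/idP/idP; last exact: ltn_perm_len_tperm.
apply: contraTT; rewrite -!leqNgt => h.
have/(ltn_perm_len_tperm ij) : ((u * tperm i j)^-1 i < (u * tperm i j)^-1 j)%N.
  rewrite invMg tpermV !permM tpermL tpermR ltn_neqAle h andbT.
  by rewrite -[_ == _ :> nat]/(_ == _ :> 'I_n) (inj_eq perm_inj) -val_eqE /=; lia.
by rewrite -mulgA tperm2 mulg1 => /ltnW.
Qed.

Definition simple s := s \in simple_refls n.

Lemma simpleP s : reflect (exists i j : 'I_n, j = i.+1 :> nat /\ s = tperm i j) (simple s).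
Proof.
apply: (iffP idP); rewrite /simple inE.
  by move=> /existsP[i /existsP[j /andP[/eqP ? /eqP ?]]]; exists i, j.
move=> [i [j [? ?]]]; apply/existsP; exists i; apply/existsP; exists j.
by apply/andP; split; apply/eqP.
Qed.

Lemma simple_mulKg s x : simple s -> x * s * s = x.
Proof. by move=> /simpleP[i [j [_ ->]]]; rewrite -mulgA tperm2 mulg1. Qed.

Definition descent s x := (perm_len (x * s) < perm_len x)%N.

(** The values exchanged by [s] are adjacent, so only the pair of their positions changes its
    inversion status. *)
Lemma perm_len_simple_up s x : simple s -> ~~ descent s x -> perm_len (x * s) = (perm_len x).+1.
Proof.
move=> /simpleP[i [j [ij ->]]]; have lij : (i < j)%N by rewrite ij.
rewrite /descent -leqNgt => le.
have ab : (x^-1 i < x^-1 j)%N.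
  rewrite ltnNge; apply/negP => ge.
  have : ((x * tperm i j)^-1 i < (x * tperm i j)^-1 j)%N.
    rewrite invMg tpermV !permM tpermL tpermR ltn_neqAle ge andbT.
    by rewrite -[_ == _ :> nat]/(_ == _ :> 'I_n) (inj_eq perm_inj) -val_eqE /=; lia.
  by move/(ltn_perm_len_tperm lij); rewrite -mulgA tperm2 mulg1; lia.
rewrite /perm_len -!/(invset _).
have -> : invset (x * tperm i j) = (x^-1 i, x^-1 j) |: invset x.
  apply/setP => -[y z]; rewrite !inE /= !permM xpair_eqE.
  rewrite -[y == _](inj_eq (@perm_inj _ x)) -[z == _](inj_eq (@perm_inj _ x)) !permKV.
  have h1 : x y = i :> nat -> x z = j :> nat -> (y < z)%N.
    by move=> /ord_inj ey /ord_inj ez; move: ab; rewrite -ey -ez !permK.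
  have h2 : x y = j :> nat -> x z = i :> nat -> (z < y)%N.
    by move=> /ord_inj ey /ord_inj ez; move: ab; rewrite -ey -ez !permK.
  have h3 : x y = x z :> nat -> y = z :> nat by move=> /ord_inj/perm_inj ->.
  rewrite !tpermVE -!val_eqE /=.
  by do 4?case: eqP => ? /=; lia.
rewrite cardsU1 inE /= !permKV.
by have -> : (j < i)%N = false by [lia]; rewrite andbF.
Qed.

Lemma descent_mulr s x : simple s -> descent s (x * s) = ~~ descent s x.
Proof.
move=> ss; rewrite /descent simple_mulKg //.
have [|/(perm_len_simple_up ss)->] := boolP (descent s x); rewrite /descent; lia.
Qed.

Lemma bruhat_refl x : bruhat_le x x.
Proof. exact: connect0. Qed.

Lemma bruhat_trans : transitive (@bruhat_le n).
Proof. exact: connect_trans. Qed.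

Lemma bruhat_lt_len x y : bruhat_le x y -> x != y -> (perm_len x < perm_len y)%N.
Proof.
move=> /connectP[p + ->]; elim: p x => [|z p IH] x /=; first by rewrite eqxx.
move=> /andP[/existsP[i /existsP[j /and3P[_ _ lt]]]] zp _.
have [<- //|/(IH _ zp)] := eqVneq z (last z p).
exact: ltn_trans.
Qed.

Lemma bruhat_anti x y : bruhat_le x y -> bruhat_le y x -> x = y.
Proof.
move=> xy yx; apply/eqP; apply: contraT => ne.
have := bruhat_lt_len xy ne; have := bruhat_lt_len yx.
by rewrite eq_sym => /(_ ne); lia.
Qed.

Lemma bruhat_leq_len x y : bruhat_le x y -> (perm_len x <= perm_len y)%N.
Proof. by have [->//|ne /bruhat_lt_len /(_ ne)/ltnW] := eqVneq x y. Qed.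

Lemma bruhat_stepP x y :
  reflect (exists i j : 'I_n, [/\ (i < j)%N, y = x * tperm i j & (x^-1 i < x^-1 j)%N])
    (bruhat_step x y).
Proof.
apply: (iffP idP) => [/existsP[i /existsP[j /and3P[ne /eqP-> lt]]]|[i [j [ij -> lt]]]].
  have [ij|ij] := ltnP i j; first by exists i, j; split; rewrite // -perm_len_tperm.
  have ji : (j < i)%N by rewrite ltn_neqAle ij andbT eq_sym.
  by exists j, i; rewrite tpermC; split; rewrite // -perm_len_tperm // tpermC.
apply/existsP; exists i; apply/existsP; exists j.
by rewrite eqxx perm_len_tperm // lt -val_eqE /= neq_ltn ij.
Qed.

Lemma bruhat_up s x : simple s -> ~~ descent s x -> bruhat_le x (x * s).
Proof.
move=> /[dup] ss /simpleP[i [j [ij se]]] /(perm_len_simple_up ss) e.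
apply: connect1; apply/existsP; exists i; apply/existsP; exists j.
by rewrite e ltnS leqnn -val_eqE /= ij -se eqxx neq_ltn ltnSn.
Qed.

Lemma bruhat_down s x : simple s -> descent s x -> bruhat_le (x * s) x.
Proof.
move=> ss d; rewrite -{2}(simple_mulKg x ss); apply: bruhat_up => //.
by rewrite descent_mulr // d.
Qed.

(** Conjugation by [s] turns the transposition of [i] and [j] into that of their images, and [s]
    reverses the order of [i < j] only if it is itself that transposition, in which case
    [x * s = y]. *)
Lemma bruhat_step_mulr s x y : simple s -> bruhat_step x y ->
  x * s = y \/ bruhat_step (x * s) (y * s).
Proof.
move=> /simpleP[a [b [ab ->]]] /bruhat_stepP[i [j [ij -> lt]]].
have [[ai bj]|ne] : (a = i /\ b = j) \/ ~ (a = i /\ b = j).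
  by case: (eqVneq a i) => [->|/eqP]; case: (eqVneq b j) => [->|/eqP]; tauto.
  by left; rewrite ai bj.
right; apply/bruhat_stepP; exists (tperm a b i), (tperm a b j); split.
- have {}ne : ~ (a = i :> nat /\ b = j :> nat) by move=> [/ord_inj ? /ord_inj ?]; apply: ne.
  by rewrite !tpermVE -!val_eqE /=; do 4?case: eqP => ? /=; lia.
- by rewrite -tpermJ -mulgA (conjgC (tperm i j)) mulgA.
by rewrite !invMg !tpermV !permM !tpermK.
Qed.

(** * The lifting property *)

Definition mins s x := if descent s x then x * s else x.
Definition maxs s x := if descent s x then x else x * s.

Lemma mins_le s x : simple s -> bruhat_le (mins s x) x.
Proof. by rewrite /mins => ss; case: ifP => [|_]; [exact: bruhat_down|exact: bruhat_refl]. Qed.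

Lemma maxs_ge s x : simple s -> bruhat_le x (maxs s x).
Proof. by rewrite /maxs => ss; case: ifPn => [_|]; [exact: bruhat_refl|exact: bruhat_up]. Qed.

Lemma mins_mulr s x : simple s -> mins s (x * s) = mins s x.
Proof. by move=> ss; rewrite /mins descent_mulr // simple_mulKg //; case: (descent s x). Qed.

Lemma maxs_mulr s x : simple s -> maxs s (x * s) = maxs s x.
Proof. by move=> ss; rewrite /maxs descent_mulr // simple_mulKg //; case: (descent s x). Qed.

(** The lifting property, as monotonicity of the smaller and the larger element of a coset
    [{x, xs}]. Along one step from [x] to [z] the two cosets coincide, or else both [x <= z] and
    [xs <= zs] hold, and one of these gives each inequality. *)
Lemma minmaxs_homo s x y : simple s -> bruhat_le x y ->
  bruhat_le (mins s x) (mins s y) /\ bruhat_le (maxs s x) (maxs s y).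
Proof.
move=> ss /connectP[p + ->]; elim: p x => [|z p IH] x /=; first by rewrite !bruhat_refl.
move=> /andP[xz /IH[le1 le2]].
suff [h1 h2] : bruhat_le (mins s x) (mins s z) /\ bruhat_le (maxs s x) (maxs s z).
  by split; [exact: bruhat_trans le1|exact: bruhat_trans le2].
have [<-|xzs] := bruhat_step_mulr ss xz.
  by rewrite mins_mulr // maxs_mulr // !bruhat_refl.
have {}xz : bruhat_le x z := connect1 xz.
have {}xzs : bruhat_le (x * s) (z * s) := connect1 xzs.
split.
  rewrite {2}/mins; case: ifP => _; [rewrite -mins_mulr // | ].
    exact: bruhat_trans (mins_le _ ss) xzs.
  exact: bruhat_trans (mins_le _ ss) xz.
rewrite {1}/maxs; case: ifP => _; [|rewrite -(maxs_mulr z) //].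
  exact: bruhat_trans xz (maxs_ge _ ss).
exact: bruhat_trans xzs (maxs_ge _ ss).
Qed.

Lemma mins_homo s x y : simple s -> bruhat_le x y -> bruhat_le (mins s x) (mins s y).
Proof. by move=> ss /(minmaxs_homo ss)[]. Qed.

Lemma bruhat_mulr_le s x y : simple s -> descent s y -> bruhat_le x y -> bruhat_le (x * s) y.
Proof.
move=> ss d /(minmaxs_homo ss)[_]; rewrite {2}/maxs d; apply: bruhat_trans.
by rewrite -maxs_mulr //; apply: maxs_ge.
Qed.

(** * The identity as least element, and parabolic subgroups *)

(** Without descents the positions of consecutive values increase, so the inverse of [x] is strictly
    increasing and hence the identity. *)
Lemma descent_exists x : x != 1 -> exists2 s, simple s & descent s x.
Proof.
move=> x1; suff : [exists s, simple s && descent s x] by case/existsP => s /andP[]; exists s.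
apply: contraNT x1 => /existsPn h.
have inc (i j : 'I_n) : j = i.+1 :> nat -> (x^-1 i < x^-1 j)%N.
  move=> ij; have lij : (i < j)%N by rewrite ij.
  have ss : simple (tperm i j) by apply/simpleP; exists i, j.
  have := h (tperm i j); rewrite ss /= => /(perm_len_simple_up ss) e.
  by rewrite -perm_len_tperm // e.
have ge (i : 'I_n) : (i <= x^-1 i)%N.
  case: i => i; elim: i => [//|i IH] lt /=.
  apply: leq_ltn_trans (IH (ltnW lt)) (inc (Ordinal _) (Ordinal lt) _); exact: erefl.
have le (i : 'I_n) : (x^-1 i <= i)%N.
  case: i => i lt; have [m] := ubnP (n - i); elim: m i lt => // m IH i lt nm.
  have [lt'|ge'] := ltnP i.+1 n.
    have := IH _ lt'; have := inc (Ordinal lt) (Ordinal lt') erefl => /=; lia.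
  by have := ltn_ord (x^-1 (Ordinal lt)) => /=; lia.
rewrite -invg_eq1; apply/eqP/permP => i; rewrite perm1; apply/ord_inj/eqP.
by rewrite eqn_leq ge le.
Qed.

Lemma perm_len1 : perm_len (1 : {perm 'I_n}) = 0%N.
Proof.
rewrite /perm_len; apply/eqP; rewrite cards_eq0; apply/eqP/setP => -[i j].
by rewrite !inE !perm1 /=; lia.
Qed.

Lemma bruhat_ge1 x : bruhat_le 1 x.
Proof.
have [m] := ubnP (perm_len x); elim: m x => // m IH x lt.
have [->|/descent_exists[s ss d]] := eqVneq x 1; first exact: bruhat_refl.
by apply: bruhat_trans (bruhat_down ss d); apply: IH; move: d; rewrite /descent; lia.
Qed.

(* Holds for every [q] in [<<J>>], and in this form visibly passes to Bruhat-smaller elements. *)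
Definition preserves_blocks J (q : {perm 'I_n}) :=
  forall i j z : 'I_n, j = i.+1 :> nat -> tperm i j \notin J -> (q z <= i)%N = (z <= i)%N.

(** A generator in [J] is not the exchange of [i] and [i + 1], so it maps the values up to [i] among
    themselves. *)
Lemma preserves_blocks_gen J q : J \subset simple_refls n -> q \in <<J>> -> preserves_blocks J q.
Proof.
move=> /subsetP sJ /gen_prodgP[m [c cJ ->]] i j z ij nJ.
elim: m c cJ z => [|m IH] c cJ z; first by rewrite big_ord0 perm1.
rewrite big_ord_recl permM IH // {IH}.
have := cJ ord0; move: (c ord0) => t tJ.
have /simpleP[a [b [ab e]]] : simple t by apply: sJ.
have : ~ (a = i :> nat).
  move=> /ord_inj ai; have bj : b = j by apply: ord_inj; rewrite ab ij ai.
  by move: nJ; rewrite -ai -bj -e tJ.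
by rewrite e tpermVE -!val_eqE /=; do 4?case: eqP => ? /=; lia.
Qed.

(** Let a step up from [x] swap the values [a < b], with [a] placed before [b] in [x]. If
    [a <= i < b], block preservation of the upper element puts [b] at a position up to [i] and [a]
    at a later one, a contradiction. So [a] and [b] lie in the same block. *)
Lemma preserves_blocks_le J x y : bruhat_le x y -> preserves_blocks J y -> preserves_blocks J x.
Proof.
move=> /connectP[p + ->]; elim: p x => [//|u p IH] x /= /andP[xu up] yJ.
have {IH}uJ := IH _ up yJ => i j z ij nJ.
move: xu => /bruhat_stepP[a [b [lt e le]]].
have h (w : 'I_n) : (tperm a b (x w) <= i)%N = (w <= i)%N by rewrite -permM -e (uJ i j).
rewrite -(h z) tpermVE; have := h (x^-1 a); have := h (x^-1 b).
rewrite !permKV tpermL tpermR -!val_eqE /=.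
by do 4?case: eqP => ? /=; lia.
Qed.

(** If [s] is not in [J], there is a cut between [i] and [i + 1], so the position of [i] precedes
    that of [i + 1] and [s] is no descent. *)
Lemma preserves_blocks_descent J s x : preserves_blocks J x -> simple s -> descent s x -> s \in J.
Proof.
move=> xJ /[dup] ss /simpleP[i [j [ij e]]]; apply: contraTT => nJ.
have lij : (i < j)%N by rewrite ij.
have := perm_len_tperm x lij; rewrite -e /descent.
have := xJ _ _ (x^-1 i) ij; have := xJ _ _ (x^-1 j) ij; rewrite -e !permKV => /(_ nJ) + /(_ nJ).
by lia.
Qed.

Lemma longest_descent J s v : longest_of_parabolic J v -> s \in J -> descent s v.
Proof.
move=> [sJ vJ max] sJ'; apply: contraT => nd.
have := max (v * s); rewrite perm_len_simple_up //; last exact: (subsetP sJ).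
by rewrite ltnn groupM // ?mem_gen // => /(_ isT).
Qed.

(** Strip a descent [s] from [p]. If [s] is in [J], the lifting property replaces the maximum [q]
    for [p * s] by the larger of [q] and [qs]. Otherwise elements below [v] do not have [s] as a
    descent, so lying below [p] and below [p * s] mean the same for them. *)
Lemma parabolic_meet_max J v p : longest_of_parabolic J v ->
  exists2 q, bruhat_le q v & forall x, bruhat_le x v -> bruhat_le x p = bruhat_le x q.
Proof.
move=> vJ; have [m] := ubnP (perm_len p); elim: m p => // m IH p lt.
have [->|/descent_exists[s ss d]] := eqVneq p 1.
  by exists 1 => //; apply: bruhat_ge1.
have [|q qv hq] := IH (p * s); first by move: d; rewrite /descent; lia.
case sJ : (s \in J).
  exists (maxs s q).
    have := (minmaxs_homo ss qv).2; rewrite {2}/maxs.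
    by rewrite (longest_descent vJ sJ).
  move=> x xv; apply/idP/idP => [xp|].
    have := mins_homo ss xp; rewrite {2}/mins d hq; last first.
      exact: bruhat_trans (mins_le _ ss) xv.
    move=> /(minmaxs_homo ss)[_]; apply: bruhat_trans.
    apply: bruhat_trans (maxs_ge _ ss) _.
    by rewrite /mins; case: ifP => _; rewrite ?maxs_mulr // bruhat_refl.
  have : bruhat_le q p.
    by apply: bruhat_trans (bruhat_down ss d); rewrite hq // bruhat_refl.
  move=> /(minmaxs_homo ss)[_]; rewrite {2}/maxs d => le xq.
  exact: bruhat_trans xq le.
exists q => // x xv; rewrite -hq //; apply/idP/idP => [xp|xp].
  have nd : ~~ descent s x.
    apply/negP => dx; move: sJ; rewrite (preserves_blocks_descent _ ss dx) //.
    by apply: preserves_blocks_le xv _; case: vJ => h1 h2 _; apply: preserves_blocks_gen.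
  by have := mins_homo ss xp; rewrite /mins d (negPf nd).
by apply: bruhat_trans xp (bruhat_down ss d).
Qed.

(** A descent [s] of the maximum [q] lies in [J] because [q <= v] preserves blocks, and the interval
    below [q] is then stable under right multiplication by [s]. *)
Lemma parabolic_meet_stable J v p : longest_of_parabolic J v ->
  (forall x, bruhat_le x v -> bruhat_le x p -> x = 1) \/
  exists2 s, s \in J & forall x, bruhat_le x v -> bruhat_le (x * s) p = bruhat_le x p.
Proof.
move=> vJ; have [q qv hq] := parabolic_meet_max p vJ.
have [q1|/descent_exists[s ss d]] := eqVneq q 1.
  left=> x xv; rewrite hq // q1 => x1; apply: bruhat_anti => //; exact: bruhat_ge1.
have sJ : s \in J.
  apply: preserves_blocks_descent ss d.
  by apply: preserves_blocks_le qv _; case: vJ => h1 h2 _; apply: preserves_blocks_gen.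
right; exists s => // x xv; rewrite !hq //; last first.
  by apply: bruhat_mulr_le => //; apply: longest_descent vJ sJ.
apply/idP/idP => h; last exact: bruhat_mulr_le.
by rewrite -(simple_mulKg x ss); apply: bruhat_mulr_le.
Qed.

(** If all of [J] were descents of [x], multiplying [1] successively by the factors of [v] would
    stay below [x], by lifting; so [v <= x]. *)
Lemma parabolic_ascent J v x : longest_of_parabolic J v -> bruhat_le x v -> x != v ->
  exists2 s, s \in J & ~~ descent s x.
Proof.
move=> [/subsetP sJ vJ _] xv xne.
suff : [exists s, (s \in J) && ~~ descent s x] by case/existsP => s /andP[]; exists s.
apply: contraNT xne => /existsPn h; apply/eqP/(bruhat_anti xv).
move: vJ => /gen_prodgP[m [c cJ ->]].
elim: m c cJ => [|m IH] c cJ; first by rewrite big_ord0; apply: bruhat_ge1.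
rewrite big_ord_recr /=; apply: bruhat_mulr_le; first exact: sJ.
  by have := h (c ord_max); rewrite cJ /= negbK.
by apply: IH.
Qed.

End Bruhat.

Import GRing.Theory.

(** * The bar complex of [L_v] with coefficients in [k_E] *)

Section Bar.
Local Open Scope ring_scope.
Variables (k : fieldType) (n : nat) (v : {perm 'I_n}).
Notation T := {perm 'I_n}.
Notation I := (IBasis n).
Implicit Types (a b c : I) (g : seq I -> k) (f : seq I -> T -> k).
Implicit Types (s t : seq I) (x y : T) (E : pred T).

Definition tgt a : T := (val a).1.
Definition src a : T := (val a).2.

Lemma tgt_le_src a : bruhat_le (tgt a) (src a).
Proof. exact: (valP a). Qed.

Definition xi x y (xy : bruhat_le x y) : I := exist _ (x, y) xy.

Lemma IBasis_eq a b : tgt a = tgt b -> src a = src b -> a = b.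
Proof.
move=> e1 e2; apply: val_inj; move: e1 e2; rewrite /tgt /src.
by case: (val a) (val b) => [? ?] [? ?] /= -> ->.
Qed.

Variant mulB_spec a b : bool -> option I -> Type :=
| MulBSome c of src a = tgt b & tgt c = tgt a & src c = src b : mulB_spec a b true (Some c)
| MulBNone of src a != tgt b : mulB_spec a b false None.

Lemma mulBP a b : mulB_spec a b (src a == tgt b) (mulB a b).
Proof.
rewrite /mulB -/(src a) -/(tgt b) -/(tgt a) -/(src b).
case: eqVneq => e; last exact: MulBNone.
have le : bruhat_le (tgt a) (src b).
  by apply: bruhat_trans (tgt_le_src a) _; rewrite e; apply: tgt_le_src.
case: insubP => [c _ vc|]; last by rewrite /= le.
by apply: MulBSome; rewrite // /tgt /src vc.
Qed.

Definition eps a : k := (val a == (v, v))%:R.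

Lemma epsE a : eps a = ((tgt a == v) && (src a == v))%:R.
Proof. by rewrite /eps /tgt /src -xpair_eqE -surjective_pairing. Qed.

Definition consmul g a b s : k := if mulB a b is Some c then g (c :: s) else 0.

(** This is the module axiom for [L_v]: if the product is the idempotent at [v], the middle vertex
    lies between [v] and [v], hence equals [v]. *)
Lemma eps_mulB a b : (if mulB a b is Some c then eps c else 0) = eps a * eps b.
Proof.
case: mulBP => [c e1 e2 e3|ne].
  rewrite !epsE e2 e3 -e1 -natrM mulnb; congr (_%:R).
  case: (eqVneq (tgt a) v) => ta; case: (eqVneq (src b) v) => sb; rewrite /= ?andbF ?andbT //=.
  suff -> : src a = v by rewrite eqxx.
  apply: bruhat_anti.
    by rewrite -sb e1 tgt_le_src.
  by rewrite -{1}ta tgt_le_src.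
rewrite !epsE -natrM mulnb; case: (eqVneq (src a) v) => sa; rewrite ?andbF //.
have -> : (tgt b == v) = false by rewrite -sa eq_sym (negPf ne).
by rewrite andbF.
Qed.

(* The part of the bar differential (with opposite sign) that does not involve the action on the
   coefficients; [eps] is the action on the simple module at [v]. *)
Fixpoint bar g s : k :=
  if s is a :: s' then
    if s' is b :: s'' then consmul g a b s'' - bar (fun t => g (a :: t)) s'
    else eps a * g [::]
  else 0.

Lemma barE g a b s : bar g (a :: b :: s) = consmul g a b s - bar (fun t => g (a :: t)) (b :: s).
Proof. by []. Qed.

Lemma consmul_ext g g' a b s :
  (forall t, size t = (size s).+1 -> g t = g' t) -> consmul g a b s = consmul g' a b s.
Proof. by rewrite /consmul => h; case: mulB => // c; apply: h. Qed.

Lemma bar_ext g g' s :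
  (forall t, size t = (size s).-1 -> g t = g' t) -> bar g s = bar g' s.
Proof.
elim: s g g' => [//|a [|b s] IH] g g' h; first by rewrite /= h.
rewrite !barE (consmul_ext _ _ h); congr (_ - _).
by apply: IH => t st; apply: h => /=; rewrite st.
Qed.

Lemma barB g g' s : bar (fun t => g t - g' t) s = bar g s - bar g' s.
Proof.
elim: s g g' => [|a [|b s] IH] g g'; first by rewrite /= subr0.
  by rewrite /= mulrBr.
rewrite !barE IH /consmul; case: mulB => [c|]; ring.
Qed.

Lemma bar0 s : bar (fun _ => 0) s = 0.
Proof.
elim: s => [//|a [|b s] IH]; first by rewrite /= mulr0.
by rewrite barE IH subr0 /consmul; case: mulB.
Qed.

Lemma barZ (l : k) g s : bar (fun t => l * g t) s = l * bar g s.
Proof.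
elim: s g => [|a [|b s] IH] g; first by rewrite /= mulr0.
  by rewrite /= mulrCA.
by rewrite !barE IH /consmul; case: mulB => [c|]; ring.
Qed.

(** Associativity of the partial product, with a continuation [F] to match two nested uses of
    [consmul]. *)
Lemma mulBA a b c (F : I -> k) :
  (if mulB a b is Some d then if mulB d c is Some e then F e else 0 else 0) =
  (if mulB b c is Some d then if mulB a d is Some e then F e else 0 else 0).
Proof.
case: (mulBP a b) => [d e1 e2 e3|ne]; case: (mulBP b c) => [e e4 e5 e6|ne'] //.
- case: mulBP => [h h1 h2 h3|]; last by rewrite e3 e4 eqxx.
  case: mulBP => [h' h1' h2' h3'|]; last by rewrite e1 e5 eqxx.
  by congr F; apply: IBasis_eq; congruence.
- by case: mulBP => [h h1 h2 h3|//]; rewrite -h1 e3 eqxx in ne'.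
by case: mulBP => [h h1 h2 h3|//]; rewrite h1 e5 eqxx in ne.
Qed.

Lemma bar_bar g s : bar (bar g) s = 0.
Proof.
elim: s g => [//|a [|b s] IH] g; first by rewrite /= mulr0.
rewrite barE.
(* [L] is the part of [bar g (a :: t)] in which [a] meets its right neighbour, or acts on [L_v] if
   there is none; the induction hypothesis kills the remainder. *)
pose L t := if t is c :: t' then consmul g a c t' else eps a * g [::].
have -> : bar (fun t => bar g (a :: t)) (b :: s) = bar L (b :: s).
  rewrite (@bar_ext _ (fun t => L t - bar (fun t' => g (a :: t')) t)) ?barB ?IH ?subr0 //.
  by case=> [|c t] _ //=; rewrite subr0.
case: s {IH} => [|c s].
  have := eps_mulB a b; rewrite /consmul /= mulrA [eps b * _]mulrC.
  by case: mulB => [d|] <-; ring.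
have := mulBA a b c (fun e => g (e :: s)); rewrite {1}/consmul barE {1}/consmul.
rewrite /L /consmul; case: (mulB a b) => [d|] h.
  rewrite barE /consmul h opprD opprK addrACA subrr add0r.
  exact: addNr.
by rewrite -h bar0 !subr0.
Qed.

Definition supp E f := forall s x, ~~ E x -> f s x = 0.

(* Since [L_v] is one-dimensional, a cochain with values in the module [k_E] with basis a convex
   set [E] is a function [seq I -> T -> k] supported on [E]. *)
Definition act E f s x : k := if s is a :: t then ((x == tgt a) && E x)%:R * f t (src a) else 0.

Definition dif E f s x : k := act E f s x - bar (f^~ x) s.

Lemma dif_ext E f f' s :
  (forall t, size t = (size s).-1 -> f t =1 f' t) -> dif E f s =1 dif E f' s.
Proof.
move=> h x; rewrite /dif; congr (_ - _); last by apply: bar_ext => t /h.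
by case: s h => [//|a s] h /=; rewrite h.
Qed.

Lemma supp_dif E f : supp E f -> supp E (dif E f).
Proof.
move=> sf s x Ex; rewrite /dif (_ : act _ _ _ _ = 0); last first.
  by case: s => //= a s; rewrite (negPf Ex) andbF mul0r.
by rewrite (@bar_ext _ (fun=> 0)) ?bar0 ?subrr // => t _; apply: sf.
Qed.

Lemma difB E f f' s x : dif E (fun t y => f t y - f' t y) s x = dif E f s x - dif E f' s x.
Proof. by rewrite /dif barB /act; case: s => [|a s]; ring. Qed.

Definition convex E := forall x y z, bruhat_le x y -> bruhat_le y z -> E x -> E z -> E y.

(** Convexity serves to compare acting by [a] and [b] in turn with acting by their product: if the
    outer vertices lie in [E], so does the middle one. *)
Lemma dif_dif E f s x : convex E -> supp E f -> dif E (dif E f) s x = 0.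
Proof.
move=> cE sf; rewrite /dif.
rewrite (_ : bar _ s = bar (fun t => act E f t x) s); last first.
  by rewrite barB bar_bar subr0.
case: s => [|a s]; first by rewrite /= subrr.
rewrite {1}/act; set l := (_ && _)%:R.
case: s => [|b s]; first by rewrite /dif /= subrr !mulr0 subrr.
rewrite barE (_ : bar (fun t => act E f (a :: t) x) (b :: s) =
  l * bar (f^~ (src a)) (b :: s)); last exact: barZ.
rewrite {1}/act mulrBr opprB addrA subrK.
rewrite /consmul; case: mulBP => [c e1 e2 e3|ne]; last by rewrite mul0r mulr0 subrr.
rewrite /act e2 e3 -/l /= /l; case: eqVneq => [ex|] /=; last by rewrite !mul0r subrr.
case Ex: (E x) => /=; last by rewrite !mul0r subrr.
have [Eb|nEb] := boolP (E (src b)); last by rewrite sf // !mulr0 subrr.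
rewrite (cE x (src a) (src b)) ?mul1r ?subrr // ?ex ?tgt_le_src // e1.
exact: tgt_le_src.
Qed.

Definition cocycle E i f := supp E f /\ forall s, size s = i.+1 -> dif E f s =1 fun=> 0.

Definition bounds E i f :=
  if i is i'.+1 then exists2 g, supp E g & forall s, size s = i -> f s =1 dif E g s
  else f [::] =1 fun=> 0.

Definition Hzero E i := forall f, cocycle E i f -> bounds E i f.

Definition Hnonzero E i := exists2 f, cocycle E i f & ~ bounds E i f.

(** * Contracting homotopy from a monotone map below the identity that moves [v] *)

Section Contraction.
Variables (m : T -> T) (E : pred T).
Hypotheses (m_homo : forall x y, bruhat_le x y -> bruhat_le (m x) (m y))
  (m_le : forall x, bruhat_le (m x) x) (mv : m v != v) (Em : forall x, E (m x) = E x).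

Definition down x : I := xi (m_le x).
Definition mapm a : I := xi (m_homo (tgt_le_src a)).

(* The standard homotopy between the identity of a nerve and a functor [m] with a natural
   transformation [down]: alternating sum of [m x0 <= ... <= m xj <= xj <= ... <= xi]. *)
Fixpoint prism g x s : k :=
  g (down x :: s) -
  if s is a :: s' then (tgt a == x)%:R * prism (fun t => g (mapm a :: t)) (src a) s' else 0.

Lemma prismE g x a s : prism g x (a :: s) =
  g (down x :: a :: s) - (tgt a == x)%:R * prism (fun t => g (mapm a :: t)) (src a) s.
Proof. by []. Qed.

Lemma prism_ext g g' x s :
  (forall t, size t = (size s).+1 -> g t = g' t) -> prism g x s = prism g' x s.
Proof.
elim: s g g' x => [|a s IH] g g' x h; rewrite /= h //; congr (_ - _ * _).
by apply: IH => t st; apply: h; rewrite /= st.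
Qed.

Lemma prismB g g' x s : prism (fun t => g t - g' t) x s = prism g x s - prism g' x s.
Proof.
elim: s g g' x => [|a s IH] g g' x /=; first by rewrite !subr0.
by rewrite IH; ring.
Qed.

Lemma prismZ (l : k) g x s : prism (fun t => l * g t) x s = l * prism g x s.
Proof.
elim: s g x => [|a s IH] g x /=; first by rewrite !subr0.
by rewrite IH; ring.
Qed.

Lemma prism0 x s : prism (fun=> 0) x s = 0.
Proof. by elim: s x => [|a s IH] x /=; rewrite ?IH ?mulr0 subr0. Qed.

Lemma eps_down x : eps (down x) = 0.
Proof.
rewrite epsE /tgt /src /=; case: (eqVneq x v) => [->|]; last by rewrite andbF.
by rewrite (negPf mv).
Qed.

(** The naturality square of [down]: both composites are the relation from [m x] to [src a]. *)
Lemma consmul_down g x a s : consmul g (down x) a s =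
  (tgt a == x)%:R * consmul g (mapm a) (down (src a)) s.
Proof.
rewrite /consmul; case: mulBP => [c e1 e2 e3|ne]; last first.
  by rewrite eq_sym in ne; rewrite /tgt in ne *; rewrite (negPf ne) mul0r.
rewrite -{1}e1 eqxx mul1r.
case: mulBP => [d d1 d2 d3|]; last by rewrite eqxx.
by congr (g (_ :: _)); apply: IBasis_eq; rewrite ?e2 ?e3 ?d2 ?d3 // /tgt /= -/(tgt a) -e1.
Qed.

Lemma consmul_mapm g a b c s : mulB a b = Some c ->
  consmul g (mapm a) (mapm b) s = g (mapm c :: s).
Proof.
case: mulBP => // c' e1 e2 e3 [<-]; rewrite /consmul.
case: mulBP => [d d1 d2 d3|]; last by rewrite /src /tgt /= -/(src a) -/(tgt b) e1 eqxx.
by congr (g (_ :: _)); apply: IBasis_eq; rewrite ?d2 ?d3 /src /tgt /= -?/(src _) -?/(tgt _) ?e2 ?e3.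
Qed.

(** Terms of neighbouring prism summands cancel by naturality of [down], and the other faces match
    by functoriality of [m]. The last face vanishes because [m v != v] makes [down] act by zero on
    [L_v]. *)
Lemma prism_bar g x s : prism (bar g) x s + bar (prism g x) s = 0.
Proof.
elim: s g x => [|a s IH] g x.
  by rewrite /= eps_down mul0r subr0 addr0.
rewrite prismE; set l := (tgt a == x)%:R.
(* The terms of [bar g (mapm a :: t)] in which [mapm a] is multiplied into its neighbour. *)
pose L t := if t is c :: t' then consmul g (mapm a) c t' else 0.
have -> : prism (fun t => bar g (mapm a :: t)) (src a) s =
  prism L (src a) s + bar (prism (fun t => g (mapm a :: t)) (src a)) s.
  rewrite (@prism_ext _ (fun t => L t - bar (fun t' => g (mapm a :: t')) t)); last first.
    by case.
  by rewrite prismB; congr (_ + _); apply/eqP; rewrite eq_sym -addr_eq0 addrC IH.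
have -> : bar g (down x :: a :: s) =
  consmul g (down x) a s - bar (fun t => g (down x :: t)) (a :: s) by [].
case: s {IH} => [|b s].
  by rewrite /= consmul_down -/l; ring.
rewrite barE [bar (prism g x) _]barE (_ : bar (fun t => prism g x (a :: t)) _ =
  bar (fun t => g (down x :: a :: t)) (b :: s) -
  l * bar (prism (fun t => g (mapm a :: t)) (src a)) (b :: s)); last first.
  by rewrite -barZ -barB; apply: bar_ext => t _; rewrite prismE.
rewrite prismE consmul_down -/l.
rewrite (_ : consmul (prism g x) a b s = (src a == tgt b)%:R *
   (consmul (fun t => g (down x :: t)) a b s -
    l * prism (fun t => L (mapm b :: t)) (src b) s)); last first.
  rewrite /consmul; have := @consmul_mapm g a b.
  case: (mulBP a b) => [c e1 e2 e3|_] h; last by rewrite !mul0r.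
  rewrite prismE mul1r e2 -/l e3; congr (_ - _ * _); apply: prism_ext => t _.
  by rewrite /L (h c).
rewrite {1}/L eq_sym.
have h : src a != tgt b -> consmul (fun t => g (down x :: t)) a b s = 0.
  by rewrite /consmul; case: mulBP.
by case: eqVneq h => [_ _|_ /(_ isT)->] /=; ring.
Qed.

Definition homotopy f s x : k := (E x)%:R * prism (f^~ (m x)) x s.

Lemma homotopyE f s x : supp E f -> dif E (homotopy f) s x + homotopy (dif E f) s x = f s x.
Proof.
move=> sf; have [Ex|nEx] := boolP (E x); last first.
  rewrite supp_dif // ?sf /homotopy ?(negPf nEx) ?mul0r ?addr0 //.
  by move=> t y /negPf Ey; rewrite /homotopy Ey mul0r.
rewrite {1}/dif (_ : bar _ s = bar (prism (f^~ (m x)) x) s); last first.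
  by apply: bar_ext => t _; rewrite /homotopy Ex mul1r.
rewrite {2}/homotopy Ex mul1r prismB.
have -> : prism (bar (f^~ (m x))) x s = - bar (prism (f^~ (m x)) x) s.
  by apply/eqP; rewrite -addr_eq0 prism_bar.
rewrite opprK [X in _ + X]addrC addrA subrK.
(* The identity in the homotopy formula arises here: acting by the leading [down x] carries the
   value at [x] to [m x], and [E] contains both or neither. *)
have A0 t : act E f (down x :: t) (m x) = f t x.
  by rewrite /act /tgt /src /= eqxx Em Ex mul1r.
case: s => [|a s]; first by rewrite -A0 [prism _ _ _]subr0 add0r.
rewrite prismE; cbv beta; rewrite A0 /act eq_sym.
case: eqVneq => [ex|_] /=; last by rewrite !mul0r add0r subr0.
rewrite (_ : tgt (mapm a) = m x) -?ex // ex eqxx Em Ex /= prismZ !mul1r /homotopy.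
rewrite addrC -addrA -[RHS]addr0; congr (_ + _).
have [_|nE] := boolP (E (src a)); first by rewrite mul1r addNr.
rewrite mul0r addr0 (@prism_ext _ (fun=> 0)) ?prism0 ?oppr0 // => t _.
by rewrite sf // Em.
Qed.

Lemma Hzero_contract i : Hzero E i.
Proof.
move=> f [sf cf].
have h0 s : size s = i -> homotopy (dif E f) s =1 fun=> 0.
  move=> si x; rewrite /homotopy (@prism_ext _ (fun=> 0)) ?prism0 ?mulr0 // => t st.
  by apply: cf; rewrite st si.
case: i h0 {cf} => [|i] h0 /=.
  by move=> x; rewrite -(homotopyE _ _ sf) h0 // addr0 /dif /= subr0.
exists (homotopy f) => [s x /negPf nE|s si x]; first by rewrite /homotopy nE mul0r.
by rewrite -(homotopyE _ _ sf) h0 // addr0.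
Qed.

End Contraction.

(** * Dimension shift along [0 -> k_E -> k_E' -> L_y -> 0] when [k_E'] is acyclic *)

Definition part E f s x : k := (E x)%:R * f s x.

Lemma supp_part E f : supp E (part E f).
Proof. by move=> s x /negPf nE; rewrite /part nE mul0r. Qed.

Lemma supp_sub E E' f : subpred E E' -> supp E f -> supp E' f.
Proof. by move=> sEE sf s x nE'; apply: sf; apply: contra nE'; apply: sEE. Qed.

Section AddMaximal.
Variables (E : pred T) (y : T).
Let E' : pred T := fun x => (x == y) || E x.
Hypotheses (ymax : forall z, E z -> ~~ bruhat_le y z) (cE' : convex E') (H0 : forall i, Hzero E' i).

Let yE : ~~ E y.
Proof. by apply/negP => /ymax; rewrite bruhat_refl. Qed.

Let subE : subpred E E'. Proof. by move=> x Ex; rewrite /E' Ex orbT. Qed.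
Let suby : subpred (pred1 y) E'. Proof. by move=> x /eqP ->; rewrite /E' eqxx. Qed.

(** [k_E] is a submodule of [k_E']: no basis element with target [y] has its source in [E]. *)
Lemma dif_low f s : supp E f -> dif E' f s =1 dif E f s.
Proof.
move=> sf x; rewrite /dif; congr (_ - _); case: s => //= a s.
rewrite /E'; have [->|] := eqVneq x y; last by move=> /negPf.
rewrite (negPf yE) andbF andbT mul0r; case: eqVneq => [e|_]; last by rewrite mul0r.
rewrite sf ?mulr0 //; apply: contraL (tgt_le_src a) => /ymax.
by rewrite -e.
Qed.

Lemma dif_top f s : supp E' f -> dif (pred1 y) (part (pred1 y) f) s y = dif E' f s y.
Proof.
move=> sf; rewrite /dif; congr (_ - _); last first.
  by apply: bar_ext => t _; rewrite /part /= eqxx mul1r.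
case: s => //= a s; rewrite /E' eqxx /= andbT; case: eqVneq => [e|_]; last by rewrite !mul0r.
rewrite !mul1r /part /=; case: eqVneq => [_|ne]; first by rewrite mul1r.
rewrite mul0r sf //= /E' negb_or ne /=; apply: contraL (tgt_le_src a) => /ymax.
by rewrite -e.
Qed.

Lemma cocycle_low i f : cocycle E i f -> cocycle E' i f.
Proof.
move=> [sf cf]; split=> [|s si x]; first exact: supp_sub sf.
by rewrite dif_low // cf.
Qed.

Lemma eq_part_low f s : supp E' f -> f s y = 0 -> part E f s =1 f s.
Proof.
move=> sf fy x; rewrite /part; case: (eqVneq x y) => [->|ne]; first by rewrite fy mulr0.
have [Ex|nEx] := boolP (E x); first by rewrite mul1r.
by rewrite mul0r sf //= /E' negb_or ne.
Qed.

Lemma Hzero_low0 : Hzero E 0.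
Proof. by move=> f /cocycle_low/H0. Qed.

(** Write [f] as the coboundary of some [g] over [E']. The [y]-part of [g] is a cocycle, hence
    bounds; subtracting the coboundary of its primitive moves [g] into [E]. *)
Lemma Hzero_lowS i : Hzero (pred1 y) i -> Hzero E i.+1.
Proof.
move=> Hy f cf; have [g sg fg] := H0 (cocycle_low cf).
suff [g' [sg' g'y fg']] : exists g' : seq I -> T -> k,
  [/\ supp E' g', forall t, size t = i -> g' t y = 0 &
    forall s, size s = i.+1 -> f s =1 dif E' g' s].
  exists (part E g') => [|s si x]; first exact: supp_part.
  rewrite fg' // -dif_low; last exact: supp_part.
  by apply: dif_ext => t; rewrite si /= => ti z; rewrite eq_part_low // g'y.
have /Hy : cocycle (pred1 y) i (part (pred1 y) g).
  split=> [|s si x]; first exact: supp_part.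
  have [->|ne] := eqVneq x y; last by rewrite supp_dif //; apply: supp_part.
  by rewrite dif_top // -fg //; case: cf => sf _; rewrite sf.
case: i {Hy cf} fg => [|i] fg.
  move=> /= gy; exists g; split=> // t /size0nil ->.
  by rewrite -(gy y) /part /= eqxx mul1r.
move=> [h sh gh]; exists (fun t x => g t x - dif E' h t x); split.
- move=> t x nE; rewrite sg // supp_dif ?subrr //.
  exact: supp_sub sh.
- move=> t ti; have sh' := supp_sub suby sh; rewrite -dif_top // -[g t y]mul1r.
  have := gh t ti y; rewrite {1}/part /= eqxx => ->; apply/eqP; rewrite subr_eq0; apply/eqP.
  by apply: dif_ext => t' _ x; rewrite /part /=; case: eqVneq => [|ne]; rewrite ?mul1r // sh ?mul0r.
move=> s si x; rewrite difB dif_dif ?subr0 ?fg //; exact: supp_sub sh.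
Qed.

(** The connecting map sends [f] to its coboundary over [E']. If this is the coboundary of [h] over
    [E], then [f - h] is a cocycle over [E'], so it bounds, and the [y]-part of its primitive bounds
    [f]. *)
Lemma Hnonzero_lowS i : Hnonzero (pred1 y) i -> Hnonzero E i.+1.
Proof.
move=> [f [sf cf] nf]; have sf' := supp_sub suby sf.
have fE : forall s, part (pred1 y) f s =1 f s.
  by move=> s x; rewrite /part /=; case: eqVneq => [|ne]; rewrite ?mul1r // mul0r sf.
have F0 s : size s = i.+1 -> dif E' f s y = 0.
  by move=> si; rewrite -dif_top // -[RHS](cf s si y); apply: dif_ext => t _.
exists (part E (dif E' f)).
  split=> [|s si x]; first exact: supp_part.
  rewrite -dif_low; last exact: supp_part.
  rewrite -(dif_dif s x cE' sf'); apply: dif_ext => t; rewrite si => ti.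
  by apply: eq_part_low; rewrite ?F0 //; apply: supp_dif.
move=> [h sh fh]; apply: nf.
have sh' := supp_sub subE sh.
have /H0 : cocycle E' i (fun t x => f t x - h t x).
  split=> [t x nE|s si x]; first by rewrite sf' // sh' // subrr.
  rewrite difB (dif_low _ sh) -fh // eq_part_low ?subrr ?F0 //; exact: supp_dif.
case: i {cf F0 fh} => [|i] /=.
  move=> w x; have := w x; have [->|ne] := eqVneq x y; last by rewrite sf.
  by rewrite sh ?subr0.
move=> [u su wu]; exists (part (pred1 y) u) => [|s si x]; first exact: supp_part.
have [->|ne] := eqVneq x y.
  by rewrite dif_top // -wu // [h s y]sh ?subr0.
by rewrite sf // supp_dif //; apply: supp_part.
Qed.

End AddMaximal.

(** The witness is the identity endomorphism of [L_v]. *)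
Lemma Hnonzero_top : Hnonzero (pred1 v) 0.
Proof.
exists (fun _ x => (x == v)%:R).
  split=> [s x /negPf /= -> //|[|a [|]] // _ x].
  rewrite /dif /= epsE -!natrM !mulnb.
  have [->|] := eqVneq x v; rewrite ?andbF ?andbT ?subrr //.
  by rewrite eq_sym subrr.
by move/(_ v)/eqP; rewrite eqxx oner_eq0.
Qed.

(** * Splitting the Ext groups of the regular module by source *)

Definition merge g s j : k :=
  match onth s j, onth s j.+1 with
  | Some a, Some b => if mulB a b is Some c then g (take j s ++ c :: drop j.+2 s) else 0
  | _, _ => 0
  end.

Lemma bar_sum g s i : size s = i.+1 ->
  bar g s = \sum_(j < i) (-1) ^+ j * merge g s j +
    (-1) ^+ i * (g (take i s) * oapp eps 0 (onth s i)).
Proof.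
elim: s i g => [//|a [|b s] IH] [|i] g // si.
  by rewrite big_ord0 add0r expr0 mul1r /= mulrC.
rewrite barE (IH i); last by case: si => <-.
rewrite big_ord_recl expr0 mul1r -addrA opprD exprS mulN1r mulNr -sumrN; congr (_ + (_ + _)).
  by rewrite /consmul /merge /= !drop0.
by apply: eq_bigr => j _; rewrite lift0 exprS mulN1r mulNr.
Qed.

(** For this [E], [k_E] is the direct summand of [A] spanned by the basis elements with source
    [p]. *)
Definition lower p : pred T := fun x => bruhat_le x p.

(* The coordinate of [c] at [xi_(x,p)], and [0] when [x <= p] fails. *)
Definition entry (c : 'M[k]_(#|{: I}|, 1)) x p : k :=
  if insub (x, p) is Some b then c (enum_rank (b : I)) 0 else 0.

Lemma entryP (c c' : 'M[k]_(#|{: I}|, 1)) : (forall x p, entry c x p = entry c' x p) -> c = c'.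
Proof.
move=> h; apply/matrixP => j o; rewrite ord1 -[j]enum_valK.
by have := h (tgt (enum_val j)) (src (enum_val j)); rewrite /entry -surjective_pairing valK.
Qed.

Lemma entry_act a (c : 'M[k]_(#|{: I}|, 1)) x p :
  entry ((Defs.mact (regA k n) a : 'M_(#|{: I}|)) *m c) x p =
  ((x == tgt a) && lower p x)%:R * entry c (src a) p.
Proof.
rewrite /entry; case: insubP => [b /= xp vb|/= nxp]; last by rewrite /lower (negPf nxp) andbF mul0r.
have [tb sb] : tgt b = x /\ src b = p by rewrite /tgt /src /= vb.
rewrite /lower xp andbT !mxE (reindex enum_rank) /=; last exact/onW_bij/enum_rank_bij.
under eq_bigr => b' _ do rewrite mxE !enum_rankK.
case: insubP => [b0 /= sp v0|/= nsp]; last first.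
  rewrite mulr0 big1 // => b' _; case: mulBP => [d e1 e2 e3|]; last by rewrite mul0r.
  case: eqP => [[db]|]; last by rewrite mul0r.
  by case/negP: nsp; rewrite e1 -sb -db e3 tgt_le_src.
have [t0 s0] : tgt b0 = src a /\ src b0 = p by rewrite /tgt /src /= v0.
rewrite (bigD1 b0) //= [X in _ + X]big1 ?addr0.
  congr (_ %:R * _); congr nat_of_bool; case: mulBP => [d e1 e2 e3|]; last by rewrite t0 eqxx.
  apply/idP/idP => [/eqP[db]|/eqP e]; first by rewrite -tb -db e2.
  by apply/eqP; congr Some; apply: IBasis_eq; rewrite ?e2 ?e3 ?tb ?sb.
move=> b' ne; case: mulBP => [d e1 e2 e3|]; last by rewrite mul0r.
case: eqP => [[db]|]; last by rewrite mul0r.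
case/eqP: ne; apply: IBasis_eq; first by rewrite -e1 t0.
by rewrite -e3 db sb s0.
Qed.

Lemma supp_entry (f : cochain (simpleL k v) (regA k n)) p :
  supp (lower p) (fun t y => entry (f t) y p).
Proof. by move=> s x nE; rewrite /entry; case: insubP => [b /= xp|//]; rewrite /lower xp in nE. Qed.

Lemma entry_cobound i (f : cochain (simpleL k v) (regA k n)) s x p : size s = i.+1 ->
  entry (cobound i f s) x p = dif (lower p) (fun t y => entry (f t) y p) s x.
Proof.
move=> si; have [xp|nxp] := boolP (lower p x); last first.
  rewrite supp_dif //; last exact: supp_entry.
  by rewrite /entry; case: insubP => [b /= xp|//]; rewrite /lower xp in nxp.
rewrite /dif (bar_sum _ si) /cobound.
have eD (c c' : 'M[k]_(#|{: I}|, 1)) : entry (c + c') x p = entry c x p + entry c' x p.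
  by rewrite /entry; case: insub => [b|]; rewrite ?mxE ?addr0.
have eZ l (c : 'M[k]_(#|{: I}|, 1)) : entry (l *: c) x p = l * entry c x p.
  by rewrite /entry; case: insub => [b|]; rewrite ?mxE ?mulr0.
have e0 : entry 0 x p = 0.
  by rewrite /entry; case: insub => [b|]; rewrite ?mxE.
rewrite eD eD -addrA opprD; congr (_ + _).
  by case: s si => [//|a s] _ /=; rewrite entry_act.
congr (_ + _).
  rewrite (big_morph (fun c : 'M[k]_(#|{: I}|, 1) => entry c x p) eD e0) -sumrN.
  apply: eq_bigr => j _; rewrite eZ exprS mulN1r mulNr; congr (- (_ * _)).
  rewrite /merge; case: onth => [a|//]; case: onth => [b|//].
  by case: mulB => [c|].
rewrite eZ exprS mulN1r mulNr; congr (- (_ * _)).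
case: onth => [a|] /=; last by rewrite mulmx0 e0 mulr0.
by rewrite mul_mx_scalar eZ mulrC.
Qed.

Definition uncurried (F : T -> seq I -> T -> k) : cochain (simpleL k v) (regA k n) :=
  fun s => \matrix_(j < #|{: I}|, _ < 1) F (src (enum_val j)) s (tgt (enum_val j)).

Lemma entry_uncurried F s x p : supp (lower p) (F p) -> entry (uncurried F s) x p = F p s x.
Proof.
rewrite /entry => sF; case: insubP => [b /= xp vb|/= nxp]; last by rewrite sF.
by rewrite mxE enum_rankK /src /tgt /= vb.
Qed.

Lemma Ext_zero i : (forall p, Hzero (lower p) i) -> ~ Ext_nonzero i (simpleL k v) (regA k n).
Proof.
move=> H [f [cf nf]]; apply: nf.
have {}H p : bounds (lower p) i (fun t y => entry (f t) y p).
  apply: H; split=> [|s si x]; first exact: supp_entry.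
  rewrite -(entry_cobound f x p si) cf //.
  by rewrite /entry; case: insub => [b|]; rewrite ?mxE.
case: i cf H => [|i] cf H /=.
  apply: entryP => x p; rewrite H.
  by rewrite /entry; case: insub => [b|]; rewrite ?mxE.
(* Finite choice picks one primitive for each source [p]; [uncurried] assembles them into one
   cochain. *)
have [G GP] := @fin_all_exists T (fun=> seq I -> T -> k)
  (fun p (g : seq I -> T -> k) => supp (lower p) g /\ forall s, size s = i.+1 ->
     (fun y => entry (f s) y p) =1 dif (lower p) g s)
  (fun p => let: ex_intro2 h sh eh := H p in ex_intro _ h (conj sh eh)).
exists (uncurried G) => s si; apply: entryP => x p; rewrite entry_cobound //.
have [sG eG] := GP p; rewrite eG //; apply: dif_ext => t _ y.
by rewrite entry_uncurried.
Qed.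

Lemma Ext_nonzero_of p i : Hnonzero (lower p) i -> Ext_nonzero i (simpleL k v) (regA k n).
Proof.
move=> [f [sf cf] nf].
(* Extension of [f] by zero to the summands with source other than [p]. *)
pose F q s x : k := (q == p)%:R * f s x.
have sF q : supp (lower q) (F q).
  by move=> s x nE; rewrite /F; case: eqVneq nE => [->|] nE; rewrite ?mul0r // sf ?mulr0.
have fE s y : entry (uncurried F s) y p = f s y by rewrite entry_uncurried // /F eqxx mul1r.
exists (uncurried F); split=> [s si|bF].
  apply: entryP => x q; rewrite entry_cobound //.
  transitivity (dif (lower q) (F q) s x).
    by apply: dif_ext => t _ y; apply: entry_uncurried.
  rewrite (_ : entry 0 x q = 0); last by rewrite /entry; case: insub => [b|]; rewrite ?mxE.
  have [->|ne] := eqVneq q p.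
    by rewrite -[RHS](cf s si x); apply: dif_ext => t _ y; rewrite /F eqxx mul1r.
  rewrite (@dif_ext _ _ (fun t y => F q t y - F q t y)) ?difB ?subrr //.
  by move=> t _ y; rewrite /F (negPf ne) mul0r subrr.
apply: nf; case: i {cf} bF => [|i] /=.
  move=> F0 x; rewrite -fE F0 /entry.
  by case: insub => [b|]; rewrite ?mxE.
move=> [g Fg]; exists (fun t y => entry (g t) y p) => [|s si x]; first exact: supp_entry.
by rewrite -fE Fg // (entry_cobound g x p si).
Qed.

End Bar.

(** * Vanishing and nonvanishing for longest elements of parabolic subgroups *)

Section Parabolic.
Variables (k : fieldType) (n : nat).
Implicit Types (v x s p : {perm 'I_n}) (J : {set {perm 'I_n}}) (E : pred {perm 'I_n}).
Local Open Scope group_scope.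

Lemma eq_Hnonzero v E E' i : E =1 E' -> Hnonzero k v E i -> Hnonzero k v E' i.
Proof.
move=> eE; have sE f : supp (k := k) E f <-> supp E' f.
  by split=> sf t x nE; apply: sf; [rewrite eE | rewrite -eE].
have dE f t x : dif (k := k) v E f t x = dif v E' f t x.
  by rewrite /dif; case: t => [|a t] //=; rewrite eE.
move=> [f [/sE sf cf] nf]; exists f; first by split=> // t ti x; rewrite -dE cf.
case: i {cf} nf => [|i] nf // [g /sE sg fg]; apply: nf; exists g => // t ti x.
by rewrite fg // dE.
Qed.

Lemma Hzero_stable v E s i : simple s -> descent s v ->
  (forall x, bruhat_le x v -> E (x * s) = E x) -> Hzero k v E i.
Proof.
(* Since [E] is stable only below [v], the map is the identity elsewhere; it remains monotone
   because the elements below [v] form a down-set. *)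
move=> ss d Es; pose m x := if bruhat_le x v then mins s x else x.
have m_le x : bruhat_le (m x) x.
  by rewrite /m; case: ifP => _; [apply: mins_le | apply: bruhat_refl].
apply: (@Hzero_contract k n v m E _ m_le).
- move=> x y xy; rewrite {2}/m; case: ifP => yv; last exact: bruhat_trans (m_le x) xy.
  by rewrite /m (bruhat_trans xy yv); apply: mins_homo.
- rewrite /m bruhat_refl /mins d; apply/eqP => e.
  by move: d; rewrite /descent e ltnn.
- by move=> x; rewrite /m /mins; case: ifP => // xv; case: ifP => // _; apply: Es.
Qed.

Lemma convex_cover x s : simple s -> ~~ descent s x -> convex (fun z => (z == x * s) || pred1 x z).
Proof.
move=> ss nd a b c ab bc /= Ea Ec; have lens := perm_len_simple_up ss nd.
apply: contraT; rewrite negb_or => /andP[b1 b2].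
have ltb : (perm_len x < perm_len b)%N.
  case/orP: Ea => /eqP ea; last by apply: bruhat_lt_len; rewrite ?(eq_sym x) // -ea.
  have := bruhat_lt_len ab; rewrite ea eq_sym lens => /(_ b1); exact: ltnW.
have : (perm_len b < (perm_len x).+1)%N.
  case/orP: Ec => /eqP ec; first by rewrite -lens -ec bruhat_lt_len // ec.
  by rewrite ltnS -{1}ec bruhat_leq_len.
by rewrite ltnS leqNgt ltb.
Qed.

Lemma Ext_simples J v x : longest_of_parabolic J v -> bruhat_le x v ->
  (forall i, (i + perm_len x < perm_len v)%N -> Hzero k v (pred1 x) i) /\
  Hnonzero k v (pred1 x) (perm_len v - perm_len x).
Proof.
move=> vJ; have [d] := ubnP (perm_len v - perm_len x).
elim: d x => // d IH x; rewrite ltnS => lt xv.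
have [->|xne] := eqVneq x v.
  by rewrite subnn; split=> [i|]; [rewrite ltnNge leq_addl | exact: Hnonzero_top].
have [s sJ nd] := parabolic_ascent vJ xv xne.
have ss : simple s by case: vJ => /subsetP h _ _; apply: h.
have dv := longest_descent vJ sJ.
have lens := perm_len_simple_up ss nd.
have ltv := bruhat_lt_len xv xne.
have xsv : bruhat_le (x * s) v by apply: bruhat_mulr_le.
have [|IH1 IH2] := IH (x * s) _ xsv; first by rewrite lens; lia.
have ymax z : pred1 x z -> ~~ bruhat_le (x * s) z.
  by move=> /eqP ->; apply: contraL (leqnn (perm_len x)) => /bruhat_leq_len; rewrite lens ltnn.
have cE := convex_cover ss nd.
(* Right multiplication by [s] swaps the two elements of this set. *)
have H0 i : Hzero k v (fun z => (z == x * s) || pred1 x z) i.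
  apply: (Hzero_stable ss dv) => z _ /=.
  by rewrite (inj_eq (mulIg s)) orbC -{1}(simple_mulKg x ss) (inj_eq (mulIg s)).
split=> [[|i] lti|].
- exact: Hzero_low0 ymax H0.
- by apply: (Hzero_lowS (E := pred1 x) ymax cE H0 (IH1 i _)); rewrite lens; lia.
have -> : (perm_len v - perm_len x = (perm_len v - perm_len (x * s)).+1)%N by rewrite lens; lia.
exact: (Hnonzero_lowS (E := pred1 x) ymax cE H0 IH2).
Qed.

Lemma Hzero_lower J v p i : longest_of_parabolic J v -> (i < perm_len v)%N -> Hzero k v (lower p) i.
Proof.
move=> vJ lti; have sJ : {subset J <= simple_refls n} by case: vJ => /subsetP.
have [p1|[s /[dup] ss /sJ ss' stab]] := parabolic_meet_stable p vJ; last first.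
  exact: Hzero_stable ss' (longest_descent vJ ss) stab.
(* [v] is not [1], as its length exceeds [i]; so [1] has an ascent in [J]. *)
have [s /[dup] sJs /sJ ss nd] : exists2 s, s \in J & ~~ descent s 1.
  apply: parabolic_ascent vJ (bruhat_ge1 v) _.
  by apply: contraTneq lti => <-; rewrite perm_len1.
have dv := longest_descent vJ sJs.
have lens : perm_len s = 1%N by have := perm_len_simple_up ss nd; rewrite mul1g perm_len1.
have sv : bruhat_le s v by rewrite -[s]mul1g; apply: bruhat_mulr_le (bruhat_ge1 v).
have ymax z : lower p z -> ~~ bruhat_le s z.
  move=> zp; apply/negP => sz; have s1 := p1 s sv (bruhat_trans sz zp).
  by move: lens; rewrite s1 perm_len1.
have cE : convex (fun z => (z == s) || lower p z).
  move=> a b c _ bc _ /orP[/eqP ec|cp]; last first.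
    by rewrite /lower (bruhat_trans bc cp) orbT.
  have [//|bs] := eqVneq b s; have := bruhat_lt_len bc; rewrite ec lens => /(_ bs).
  have [->|/descent_exists[t _]] := eqVneq b 1; first by rewrite /lower bruhat_ge1.
  by rewrite /descent; lia.
have H0 j : Hzero k v (fun z => (z == s) || lower p z) j.
  (* Below [v] the enlarged set is just [{1, s}], which [s] swaps. *)
  have E1 z : bruhat_le z v -> (z == s) || lower p z = (z == s) || (z == 1).
    move=> zv; congr (_ || _); apply/idP/eqP => [|->]; first exact: p1.
    exact: bruhat_ge1.
  apply: (Hzero_stable ss dv) => z zv.
  rewrite !E1 //; last exact: bruhat_mulr_le.
  have -> : (z * s == s) = (z == 1) by rewrite -{2}[s]mul1g (inj_eq (mulIg s)).
  have -> : (z * s == 1) = (z == s) by rewrite -(simple_mulKg 1 ss) (inj_eq (mulIg s)) mul1g.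
  exact: orbC.
case: i lti => [|i] lti; first exact: Hzero_low0 ymax H0.
(* Degree [i + 1] for [lower p] comes from degree [i] for [L_s], which vanishes because
   [i + 1 < perm_len v]. *)
apply: (Hzero_lowS ymax cE H0); apply: (Ext_simples vJ sv).1.
by rewrite lens addn1.
Qed.

End Parabolic.

Theorem theorem7p1 (k : closedFieldType) (hchar : [pchar k]%R =i pred0)
  (n : nat) (J : {set {perm 'I_n}}) (v : {perm 'I_n}) :
  longest_of_parabolic J v ->
  is_grade (simpleL k v) (perm_len v).
Proof.
move=> vJ; split=> [|i lti]; last by apply: Ext_zero => p; apply: Hzero_lower vJ lti.
(* The nonzero class comes from source [1], where the summand is the simple module at [1]. *)
apply: (@Ext_nonzero_of k n v 1%g); apply: (@eq_Hnonzero k n v (pred1 1%g)) => [x|].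
  apply/eqP/idP => [->|x1]; first exact: bruhat_refl.
  by apply: bruhat_anti => //; apply: bruhat_ge1.
by have := (Ext_simples k vJ (bruhat_ge1 v)).2; rewrite perm_len1 subn0.
Qed.
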